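(* There exist a planar, 3-connected, non-complete graph $G$ with $d(S_5)=4$ and a list assignment $L$ with $|L(v)|=\min\{d(v),5\}$ for all $v\in V(G)$ such that $G$ is not $L$-colorable.
   Context: For a graph $G$, $d(v)$ denotes the degree of $v$. $S_5=\{v\in V(G): d(v)<5\}$, and $d(S_5)$ denotes the smallest distance in $G$ between two distinct connected components of the induced subgraph $G[S_5]$; if $G[S_5]$ has at most one component, $d(S_5)=0$. A list assignment $L$ assigns a set $L(v)$ of colors to each vertex; $G$ is $L$-colorable if there is a proper coloring $\varphi$ with $\varphi(v)\in L(v)$ for all $v$. *)

(* Defs.v *)
From mathcomp Require Import all_boot all_order all_algebra finmap.
From mathcomp Require Import all_classical all_reals all_analysis.

Set Implicit Arguments.
Unset Strict Implicit.
Unset Printing Implicit Defensive.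

Import Order.TTheory GRing.Theory Num.Theory numFieldNormedType.Exports.

(* Finite simple graphs. *)
Record sgraph := SGraph {
  vertex :> finType;
  adj : rel vertex;
  adj_sym : symmetric adj;
  adj_irrefl : irreflexive adj }.

Section Graph.
Local Open Scope nat_scope.
Variable G : sgraph.
Implicit Types (x y : G) (A B S : {set G}).

Definition deg x : nat := #|[set y | adj x y]|.

Definition small_deg (k : nat) : {set G} := [set x | deg x < k].

Definition complete : Prop := forall x y, x != y -> adj x y.

Definition induced S : rel G := [rel x y | [&& x \in S, y \in S & adj x y]].

Definition k_connected (k : nat) : Prop :=
  k < #|G| /\
  forall S, #|S| < k ->
    {in ~: S &, forall x y, connect (induced (~: S)) x y}.

Definition components S : {set {set G}} :=
  [set [set y in S | connect (induced S) x y] | x in S].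

Definition walk (n : nat) x y : bool :=
  [exists p : n.-tuple G, path (@adj G) x p && (last x p == y)].

(* [find] returns the least [n < #|G|] with a walk of length [n] from [x] to
   [y]. Vertices at finite distance are joined by such a walk; for vertices in
   different components of [G] the value is [#|G|], which exceeds every finite
   distance and plays the role of infinity. *)
Definition dist x y : nat := find (fun n => walk n x y) (iota 0 #|G|).

(* Since [dist] is bounded by [#|G|], that value is neutral for the minimum. *)
Definition set_dist A B : nat :=
  \big[minn/#|G|]_(x in A) \big[minn/#|G|]_(y in B) dist x y.

Definition comp_dist S : nat :=
  if #|components S| <= 1 then 0
  else \big[minn/#|G|]_(A in components S)
         \big[minn/#|G|]_(B in components S | A != B) set_dist A B.

Definition L_colorable (L : G -> {fset nat}) : Prop :=
  exists phi : G -> nat,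
    (forall x, phi x \in L x) /\ (forall x y, adj x y -> phi x != phi y).

End Graph.

Local Open Scope classical_set_scope.
Local Open Scope ring_scope.

(* [pos] places the vertices in the plane and [arc x y] parametrizes over [0, 1]
   the curve drawn for the edge [xy], from [x] to [y]; its values at non-adjacent
   pairs and outside of [0, 1] are irrelevant. *)
Definition plane_drawing (R : realType) (G : sgraph)
    (pos : G -> R * R) (arc : G -> G -> R -> R * R) : Prop :=
  [/\ injective pos,
      forall x y, adj x y ->
        [/\ {within `[0, 1], continuous (arc x y)},
            {in `[0, 1] &, injective (arc x y)},
            arc x y 0 = pos x, arc x y 1 = pos y &
            {in `[0, 1], forall t, arc y x t = arc x y (1 - t)}],
      forall x y z t, adj x y -> t \in `]0, 1[ -> arc x y t <> pos z &
      forall x y z w s t, adj x y -> adj z w ->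
        s \in `]0, 1[ -> t \in `]0, 1[ -> arc x y s = arc z w t ->
        [set x; y]%SET = [set z; w]%SET].

Definition planar (R : realType) (G : sgraph) : Prop :=
  exists (pos : G -> R * R) (arc : G -> G -> R -> R * R), plane_drawing pos arc.

(* Main.v *)
(* Let u, w be adjacent and both joined to a path x_0, ..., x_60.  In each
   triangle (t, x_i, x_(i+1)) with t = u or w, put a triangle abc, each of a, b, c
   adjacent to two of the three corners, and a centre of degree 3 adjacent to
   a, b, c.  The centres are the only vertices of degree less than 5, and two of
   them whose gadgets share a corner are at distance 4.  If the centre has the
   list {5, 6, 7} and a, b, c have {5, 6, 7} plus the colours that the two
   adjacent corners are to avoid, then one prescribed colouring of the corners
   forces a, b, c to use all of 5, 6, 7 and does not extend.  All other lists are
   {0, ..., 4}.  Fix distinct colours p, q of u, w and let r0, r1, r2 be the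
   remaining ones, so that x_i takes one of these.  Two forbidden transitions
   per edge of the path make the possible colours of four consecutive x_i
   decrease as {r0, r1, r2}, {r1, r2}, {r0}, empty.  Three edges for each of the
   20 pairs (p, q) give the 60 edges of the path. *)

From HB Require Import structures.
From Stdlib Require Import ZArith.
Require Import Defs.
From mathcomp Require Import all_boot all_order all_algebra finmap.
From mathcomp Require Import all_classical all_reals all_analysis.
From mathcomp Require Import ssrZ lra ring zify.

Set Implicit Arguments.
Unset Strict Implicit.
Unset Printing Implicit Defensive.

Import Order.TTheory GRing.Theory Num.Theory numFieldNormedType.Exports.

(** * Straight-line drawings with integer coordinates *)

Definition zpoint : Type := Z * Z.

(** Cross product of [d] and [A - P]: its sign tells apart the two sides of the line through [P] in
    direction [d]. *)
Definition side (P d A : zpoint) : Z :=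
  Z.sub (Z.mul d.1 (Z.sub A.2 P.2)) (Z.mul d.2 (Z.sub A.1 P.1)).

(** These three tests decide from the end values whether an affine [f] takes a positive, a negative
    or a zero value inside the segment. *)
Definition meets_pos (f : zpoint -> Z) (e : zpoint * zpoint) : bool :=
  Z.ltb 0 (f e.1) || Z.ltb 0 (f e.2).
Definition meets_neg (f : zpoint -> Z) (e : zpoint * zpoint) : bool :=
  Z.ltb (f e.1) 0 || Z.ltb (f e.2) 0.
Definition meets_line (f : zpoint -> Z) (e : zpoint * zpoint) : bool :=
  (Z.eqb (f e.1) 0 && Z.eqb (f e.2) 0) || Z.ltb (Z.mul (f e.1) (f e.2)) 0.

(** The default keeps the cutting line genuine when the segment is a vertex. *)
Definition direction (e : zpoint * zpoint) : zpoint :=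
  let d := (Z.sub e.2.1 e.1.1, Z.sub e.2.2 e.1.2) in
  if Z.eqb d.1 0 && Z.eqb d.2 0 then (Z.one, Z.zero) else d.

Definition normal (d : zpoint) : zpoint := (Z.opp d.2, d.1).

(* Cuts the plane along the line of the first segment, and this line along a
   perpendicular one.  A segment is passed on to each part that its interior
   meets, so that segments whose interiors intersect are never told apart.
   Moving the first segment to the end makes every segment cut eventually.  A
   vertex counts as a segment of length 0, whose interior is the point itself. *)
Fixpoint separate (T : Type) (n : nat) (es : seq (T * (zpoint * zpoint))) : bool :=
  match n, es with
  | n'.+1, e :: es' =>
    if nilp es' then true else
    let d := direction e.2 in
    let f := side e.2.1 d in
    let g := side e.2.1 (normal d) in
    let l := rcons es' e in
    let l0 := [seq a <- l | meets_line f a.2] in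
    [&& separate n' [seq a <- l | meets_pos f a.2],
        separate n' [seq a <- l | meets_neg f a.2],
        separate n' [seq a <- l0 | meets_pos g a.2],
        separate n' [seq a <- l0 | meets_neg g a.2] &
        separate n' [seq a <- l0 | meets_line g a.2]]
  | _, _ => nilp es
  end.

Section Drawing.
Variable R : realType.
Local Open Scope classical_set_scope.
Local Open Scope ring_scope.

Definition ofZ (z : Z) : R := (int_of_Z z)%:~R.

Definition segment_point (e : zpoint * zpoint) (t : R) : R * R :=
  ((1 - t) * ofZ e.1.1 + t * ofZ e.2.1, (1 - t) * ofZ e.1.2 + t * ofZ e.2.2).

Lemma ofZB x y : ofZ (Z.sub x y) = ofZ x - ofZ y.
Proof. by rewrite /ofZ -intrB -rmorphB. Qed.

Lemma ofZM x y : ofZ (Z.mul x y) = ofZ x * ofZ y.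
Proof. by rewrite /ofZ -intrM -rmorphM. Qed.

Lemma ofZ_gt0 x : (0 < ofZ x) = Z.ltb 0 x.
Proof. by rewrite /ofZ ltr0z; case: x => //= p; lia. Qed.

Lemma ofZ_lt0 x : (ofZ x < 0) = Z.ltb x 0.
Proof. by rewrite /ofZ ltrz0; case: x => //= p; lia. Qed.

Lemma ofZ_inj : injective ofZ.
Proof. by move=> x y /intr_inj /(can_inj int_of_ZK). Qed.

Definition sideR (P d : zpoint) (A : R * R) : R :=
  ofZ d.1 * (A.2 - ofZ P.2) - ofZ d.2 * (A.1 - ofZ P.1).

Lemma side_segment P d e t :
  sideR P d (segment_point e t) =
  (1 - t) * ofZ (side P d e.1) + t * ofZ (side P d e.2).
Proof. rewrite /sideR /side !ofZB !ofZM !ofZB /=; ring. Qed.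

Lemma side_pos P d e t : 0 < t < 1 -> 0 < sideR P d (segment_point e t) ->
  meets_pos (side P d) e.
Proof.
rewrite side_segment /meets_pos -!ofZ_gt0 => t01 s.
apply/negP => /negP; rewrite negb_or -!leNgt => /andP[]; nra.
Qed.

Lemma side_neg P d e t : 0 < t < 1 -> sideR P d (segment_point e t) < 0 ->
  meets_neg (side P d) e.
Proof.
rewrite side_segment /meets_neg -!ofZ_lt0 => t01 s.
apply/negP => /negP; rewrite negb_or -!leNgt => /andP[]; nra.
Qed.

Lemma side_zero P d e t : 0 < t < 1 -> sideR P d (segment_point e t) = 0 ->
  meets_line (side P d) e.
Proof.
rewrite side_segment /meets_line -ofZ_lt0 ofZM.
have z0 z : Z.eqb z 0 = (ofZ z == 0).
  apply/Z.eqb_spec/eqP => [-> //|]; exact: (@ofZ_inj z Z0).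
rewrite !z0; set a := ofZ _; set b := ofZ _ => /andP[t0 t1] s.
have [a0|a0|a0] := ltrgt0P a; have [b0|b0|b0] := ltrgt0P b => //=; nra.
Qed.

(** A point common to two interiors lies in one part of each cut, and both segments are passed on to
    that part, so the recursion could never end with them apart. *)
Lemma separateP (T : eqType) n (es : seq (T * (zpoint * zpoint))) :
  separate n es -> {in es &, forall e f, e != f -> forall s t : R,
    0 < s < 1 -> 0 < t < 1 -> segment_point e.2 s <> segment_point f.2 t}.
Proof.
elim: n es => [|n IH] [|a l] //=.
case: ifP => [/nilP-> _ e f|_]; first by rewrite !inE => /eqP-> /eqP->; rewrite eqxx.
set d := direction _; set es := rcons l a => /and5P[Hp Hn H0p H0n H00] e f.
have mem_es x : (x \in a :: l) = (x \in es) by rewrite /es mem_rcons.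
rewrite !mem_es => ein fin nef s t s01 t01 eq.
(* One cut: by induction the common point is on neither open side, so it is on the line and both
   segments meet the line. This serves for the first line and for its perpendicular. *)
have part (Q c : zpoint) (r : seq (T * (zpoint * zpoint))) :
    e \in r -> f \in r ->
    separate n [seq x <- r | meets_pos (side Q c) x.2] ->
    separate n [seq x <- r | meets_neg (side Q c) x.2] ->
    [/\ sideR Q c (segment_point e.2 s) = 0,
        meets_line (side Q c) e.2 & meets_line (side Q c) f.2].
  move=> el fl lp ln.
  have [p|m|z] := ltrgt0P (sideR Q c (segment_point e.2 s)).
  - case: (IH _ lp e f _ _ nef s t s01 t01 eq); rewrite mem_filter ?el ?fl andbT.
      exact: side_pos p.
    by apply: side_pos t01 _; rewrite -eq.
  - case: (IH _ ln e f _ _ nef s t s01 t01 eq); rewrite mem_filter ?el ?fl andbT.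
      exact: side_neg m.
    by apply: side_neg t01 _; rewrite -eq.
  - split=> //; first exact: side_zero z.
    by apply: side_zero t01 _; rewrite -eq.
have [_ e0 f0] := part _ _ _ ein fin Hp Hn.
have [||_ e1 f1] := part _ _ _ _ _ H0p H0n; rewrite ?mem_filter ?e0 ?f0 ?ein ?fin //.
case: (IH _ H00 e f _ _ nef s t s01 t01 eq);
  by rewrite !mem_filter ?e0 ?e1 ?f0 ?f1 ?ein ?fin.
Qed.

Lemma segment_point0 e : segment_point e 0 = (ofZ e.1.1, ofZ e.1.2).
Proof. by rewrite /segment_point subr0 !mul1r !mul0r !addr0. Qed.

Lemma segment_point1 e : segment_point e 1 = (ofZ e.2.1, ofZ e.2.2).
Proof. by rewrite /segment_point subrr !mul1r !mul0r !add0r. Qed.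

Lemma segment_point_diag P t : segment_point (P, P) t = (ofZ P.1, ofZ P.2).
Proof. by rewrite /segment_point /= -!mulrDl subrK !mul1r. Qed.

Lemma segment_point_rev P Q t :
  segment_point (Q, P) t = segment_point (P, Q) (1 - t).
Proof. by rewrite /segment_point /= subKr addrC [X in (_, X)]addrC. Qed.

Lemma segment_point_inj P Q : P != Q -> injective (segment_point (P, Q)).
Proof.
case: P Q => [a b] [c d] nPQ s t [] e1 e2.
have {}e1 : (s - t) * (ofZ c - ofZ a) = 0 by move: e1 => /=; lra.
have {}e2 : (s - t) * (ofZ d - ofZ b) = 0 by move: e2 => /=; lra.
move: e1 e2 => /eqP + /eqP; rewrite !mulf_eq0 !subr_eq0.
case: eqP => //= _ /eqP/ofZ_inj ca /eqP/ofZ_inj db.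
by rewrite ca db eqxx in nPQ.
Qed.

Lemma cvg_affine (t x y : R) :
  ((1 - u) * x + u * y) @[u --> t] --> (1 - t) * x + t * y.
Proof.
apply: (cvgD (cvgM (cvgB (cvg_cst _) cvg_id) (cvg_cst _)) _).
exact: (cvgM cvg_id (cvg_cst _)).
Qed.

Lemma continuous_segment_point e : continuous (segment_point e).
Proof. move=> t; exact: (cvg_pair (@cvg_affine t _ _) (@cvg_affine t _ _)). Qed.

(** With each vertex x entered as (x, x), a constant segment evaluated at 1/2, disjointness of the
    listed interiors gives at once distinct vertices, no edge through a vertex and no crossing
    edges. *)
Lemma planar_straight (G : sgraph) (E : rel G) (zpos : G -> zpoint)
    (os : seq (G * G)) n :
  (forall x y, adj x y = E x y || E y x) ->
  (forall x, (x, x) \in os) -> (forall x y, E x y -> (x, y) \in os) ->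
  separate n [seq (o, (zpos o.1, zpos o.2)) | o <- os] -> planar R G.
Proof.
move=> adjE vos eos chk.
have half01 : 0 < (2^-1 : R) < 1 by lra.
have disj o o' (s t : R) : o \in os -> o' \in os -> 0 < s < 1 -> 0 < t < 1 ->
    segment_point (zpos o.1, zpos o.2) s = segment_point (zpos o'.1, zpos o'.2) t ->
    o = o'.
  move=> oos oos' s01 t01 eq; apply/eqP/negP => /negP neq.
  case: (separateP chk (map_f _ oos) (map_f _ oos') _ s01 t01 eq).
  by apply: contraNneq neq => -[/eqP].
have zinj : injective zpos.
  move=> x y zxy.
  have := @disj (x, x) (y, y) 2^-1 2^-1 (vos x) (vos y) half01 half01.
  by rewrite /= zxy => /(_ erefl) [].
have nadj x y : adj x y -> zpos x != zpos y.
  by move=> xy; apply/eqP => /zinj exy; rewrite exy adj_irrefl in xy.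
have edge x y (t : R) : adj x y -> 0 < t < 1 -> exists o u,
    [/\ o \in os, [set o.1; o.2]%SET = [set x; y]%SET, 0 < u < 1 &
        segment_point (zpos x, zpos y) t = segment_point (zpos o.1, zpos o.2) u].
  rewrite adjE => /orP[xy|yx] t01; first by exists (x, y), t; split=> //; exact: eos.
  exists (y, x), (1 - t); split; [exact: eos|by rewrite finset.setUC|by lra|].
  exact: segment_point_rev.
have itv01 (t : R) : t \in `]0, 1[ -> 0 < t < 1 by rewrite in_itv.
exists (fun x => (ofZ (zpos x).1, ofZ (zpos x).2)).
exists (fun x y => segment_point (zpos x, zpos y)); split.
- move=> x y [/ofZ_inj e1 /ofZ_inj e2]; apply: zinj.
  by case: (zpos x) (zpos y) e1 e2 => ? ? [? ?] /= -> ->.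
- move=> x y xy; split.
  + by apply: continuous_subspaceT; exact: continuous_segment_point.
  + by move=> s t _ _; apply: segment_point_inj; exact: nadj.
  + exact: segment_point0.
  + exact: segment_point1.
  + by move=> t _; exact: segment_point_rev.
- move=> x y z t xy /itv01 t01; have [e [u [ein oxy u01 ->]]] := edge _ _ _ xy t01.
  rewrite -(segment_point_diag (zpos z) 2^-1) => eq.
  have oz := @disj e (z, z) u 2^-1 ein (vos z) u01 half01 eq.
  move: xy oxy; rewrite oz /= finset.setUid => xy ezxy.
  have /finset.set1P ex : x \in [set z]%SET by rewrite ezxy finset.set21.
  have /finset.set1P ey : y \in [set z]%SET by rewrite ezxy finset.set22.
  by rewrite ex ey adj_irrefl in xy.
- move=> x y z w s t xy zw /itv01 s01 /itv01 t01.
  have [e [u [ein <- u01 ->]]] := edge _ _ _ xy s01.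
  have [e' [u' [ein' <- u01' ->]]] := edge _ _ _ zw t01.
  by move=> /disj ->.
Qed.
End Drawing.

(** * The graph *)

Local Open Scope nat_scope.

(* [Pole s] are u and w, [Rim i] is x_i, and [Gad s i r] belongs to the triangle
   with corners [Pole s], x_i, x_(i+1): for r < 3 it is the vertex of abc that is
   adjacent to all corners but the r-th, and for r = 3 it is the centre. *)
Inductive vtx := Pole of bool | Rim of 'I_61 | Gad of bool & 'I_60 & 'I_4.

Definition vtx_code (x : vtx) : bool + 'I_61 + bool * 'I_60 * 'I_4 :=
  match x with
  | Pole s => inl (inl s)
  | Rim i => inl (inr i)
  | Gad s i r => inr (s, i, r)
  end.

Definition vtx_decode (c : bool + 'I_61 + bool * 'I_60 * 'I_4) : vtx :=
  match c with
  | inl (inl s) => Pole s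
  | inl (inr i) => Rim i
  | inr (s, i, r) => Gad s i r
  end.

Lemma vtx_codeK : cancel vtx_code vtx_decode.
Proof. by case. Qed.

HB.instance Definition _ := Finite.copy vtx (can_type vtx_codeK).

(** Each edge has just one direction here: an edge and its reverse, as two objects, could never be
    told apart by [separate]. *)
Definition arrow (x y : vtx) : bool :=
  match x, y with
  | Pole s, Pole t => ~~ s && t
  | Pole _, Rim _ => true
  | Rim i, Rim j => j == i.+1 :> nat
  | Pole s, Gad t i r => (s == t) && ((r == 1 :> nat) || (r == 2 :> nat))
  | Rim j, Gad t i r =>
      (j == i :> nat) && ((r == 0 :> nat) || (r == 2 :> nat))
      || (j == i.+1 :> nat) && ((r == 0 :> nat) || (r == 1 :> nat))
  | Gad s i q, Gad t j r => [&& s == t, i == j & q < r]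
  | _, _ => false
  end.

(** * Planarity *)

Definition zrim (i : nat) : zpoint := (Z.of_nat i.+1, Z0).
(** The edge between the poles crosses the axis at the origin, which is why the x_i start at
    abscissa 1. *)
Definition zpole (s : bool) : zpoint := (Z0, if s then Z.one else Z.opp Z.one).
Definition zscale (a : nat) (P : zpoint) : zpoint :=
  (Z.mul (Z.of_nat a) P.1, Z.mul (Z.of_nat a) P.2).
Definition zadd (P Q : zpoint) : zpoint := (Z.add P.1 Q.1, Z.add P.2 Q.2).

(* The factor 15 clears the denominators of barycentric coordinates, which are
   1/3, 1/3, 1/3 for a centre and 1/5, 2/5, 2/5 for the other [Gad]. *)
Definition zpos (x : vtx) : zpoint :=
  match x with
  | Pole s => zscale 15 (zpole s)
  | Rim i => zscale 15 (zrim i)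
  | Gad s i r =>
    let w (j : nat) := if r == 3 :> nat then 5 else if r == j :> nat then 3 else 6 in
    zadd (zscale (w 0) (zpole s)) (zadd (zscale (w 1) (zrim i)) (zscale (w 2) (zrim i.+1)))
  end.

(* The edges of the path come first in [objects], so that the first cut of
   [separate] is the line through the x_i and the edges at one pole do not cut
   the gadgets at the other. *)
Definition core : seq vtx :=
  [seq Rim (inZp i) | i <- iota 0 61] ++ [:: Pole false; Pole true].

Definition gadget (s : bool) (i : nat) : seq vtx :=
  [seq Gad s (inZp i) (inZp r) | r <- iota 0 4].

Definition corners (s : bool) (i : nat) : seq vtx :=
  [:: Pole s; Rim (inZp i); Rim (inZp i.+1)].

Definition arrows (l l' : seq vtx) : seq (vtx * vtx) :=
  [seq e <- [seq (x, y) | x <- l, y <- l'] | arrow e.1 e.2].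

Definition cells : seq (bool * nat) := [seq (s, i) | s <- [:: false; true], i <- iota 0 60].

Definition objects : seq (vtx * vtx) :=
  arrows core core ++
  flatten [seq arrows (corners c.1 c.2 ++ gadget c.1 c.2) (gadget c.1 c.2) | c <- cells] ++
  [seq (x, x) | x <- core ++ flatten [seq gadget c.1 c.2 | c <- cells]].

Definition joined (x y : vtx) : bool := arrow x y || arrow y x.

Lemma joined_sym : symmetric joined.
Proof. by move=> x y; rewrite /joined orbC. Qed.

Lemma arrow_irrefl : irreflexive arrow.
Proof. by case=> [[]|i|s i r] //=; rewrite ?ltnn ?andbF //; apply/negbTE; lia. Qed.

Lemma joined_irrefl : irreflexive joined.
Proof. by move=> x; rewrite /joined arrow_irrefl. Qed.

Definition G : sgraph := SGraph joined_sym joined_irrefl.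

Lemma mem_core_Pole s : Pole s \in core.
Proof. by rewrite mem_cat orbC; case: s. Qed.

Lemma mem_core_Rim i : Rim i \in core.
Proof.
rewrite mem_cat; apply/orP; left; apply/mapP; exists (i : nat); last by rewrite valZpK.
by rewrite mem_iota ltn_ord.
Qed.

Lemma mem_gadget s (i : 'I_60) r : Gad s i r \in gadget s i.
Proof.
apply/mapP; exists (r : nat); last by rewrite !valZpK.
by rewrite mem_iota ltn_ord.
Qed.

Lemma mem_cells s (i : 'I_60) : (s, i : nat) \in cells.
Proof. by apply/allpairs_f; [case: s|rewrite mem_iota ltn_ord]. Qed.

Lemma mem_arrows l l' x y :
  x \in l -> y \in l' -> arrow x y -> (x, y) \in arrows l l'.
Proof. by move=> xl yl xy; rewrite mem_filter xy /=; apply/allpairs_f. Qed.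

Lemma mem_catl (T : eqType) (x : T) l l' : x \in l -> x \in l ++ l'.
Proof. by rewrite mem_cat => ->. Qed.

Lemma mem_catr (T : eqType) (x : T) l l' : x \in l' -> x \in l ++ l'.
Proof. by rewrite mem_cat orbC => ->. Qed.

Lemma mem_flatten_cells (T : eqType) (f : bool * nat -> seq T) s (i : 'I_60) x :
  x \in f (s, i : nat) -> x \in flatten [seq f c | c <- cells].
Proof.
by move=> xf; apply/flattenP; exists (f (s, i : nat)); [exact: map_f (mem_cells s i)|].
Qed.

Lemma mem_objects_loop x : (x, x) \in objects.
Proof.
apply: mem_catr; apply: mem_catr; apply: (map_f (fun y => (y, y))).
case: x => [s|i|s i r].
- apply: mem_catl; exact: mem_core_Pole.
- apply: mem_catl; exact: mem_core_Rim.
apply: mem_catr; apply: (@mem_flatten_cells _ (fun c => gadget c.1 c.2) s i).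
exact: mem_gadget.
Qed.

Lemma mem_corners_Rim (i : 'I_61) (j : 'I_60) s :
  (i == j :> nat) || (i == j.+1 :> nat) -> Rim i \in corners s j.
Proof.
have -> : Rim i = Rim (inZp i) by rewrite valZpK.
by case/orP=> /eqP->; rewrite !in_cons eqxx ?orbT.
Qed.

Lemma mem_core_arrow x y :
  arrow x y -> if y is Gad _ _ _ then true else x \in core.
Proof.
case: x y => [s|i|s i r] [t|j|t j q] // _.
- exact: mem_core_Pole.
- exact: mem_core_Pole.
- exact: mem_core_Rim.
Qed.

Lemma mem_objects_arrow x y : arrow x y -> (x, y) \in objects.
Proof.
case: y => [s|i|s i r] xy.
- apply: mem_catl; apply: mem_arrows (xy); last exact: mem_core_Pole.
  exact: mem_core_arrow xy.
- apply: mem_catl; apply: mem_arrows (xy); last exact: mem_core_Rim.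
  exact: mem_core_arrow xy.
apply: mem_catr; apply: mem_catl.
apply: (@mem_flatten_cells _
  (fun c => arrows (corners c.1 c.2 ++ gadget c.1 c.2) (gadget c.1 c.2)) s i).
apply: mem_arrows (xy); last exact: mem_gadget.
rewrite /arrow in xy; case: x xy => [t|j|t j q].
- by case/andP=> /eqP-> _; apply: mem_catl; rewrite mem_head.
- by move=> ji; apply: mem_catl; apply: mem_corners_Rim; lia.
- by case/and3P=> /eqP-> /eqP-> _; apply: mem_catr; exact: mem_gadget.
Qed.

(** 300 bounds the depth of the cuts; a branch that exhausts it with segments left makes the check
    fail. *)
Lemma separate_objects : separate 300 [seq (e, (zpos e.1, zpos e.2)) | e <- objects].
Proof. by vm_cast_no_check (erefl true). Qed.

Lemma planar_G (R : realType) : planar R G.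
Proof.
exact: (@planar_straight R G arrow zpos objects 300 (fun x y => erefl)
  mem_objects_loop mem_objects_arrow separate_objects).
Qed.

(** * Adjacency inside a gadget *)

Definition role (k : nat) : 'I_4 := inZp k.

(** Numbered so that for k < 3 the vertex [Gad s i (role k)] misses exactly [corner s i k]. *)
Definition corner (s : bool) (i : 'I_60) (k : nat) : vtx :=
  match k with
  | 0 => Pole s
  | 1 => Rim (widen_ord (leqnSn 60) i)
  | _ => Rim (lift ord0 i)
  end.

Lemma roleP (P : 'I_4 -> Prop) :
  P (role 0) -> P (role 1) -> P (role 2) -> P (role 3) -> forall r, P r.
Proof.
move=> P0 P1 P2 P3 r; rewrite -[r]valZpK.
by case: r => [[|[|[|[|//]]]]].
Qed.

Lemma joined_corner s i k l : k < 3 -> l < 3 -> k != l ->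
  joined (Gad s i (role k)) (corner s i l).
Proof.
by case: k l => [|[|[|//]]] [|[|[|//]]] // _ _ _; rewrite /joined /= ?eqxx ?orbT.
Qed.

Lemma joined_Gad s i k l : k < 4 -> l < 4 -> k != l ->
  joined (Gad s i (role k)) (Gad s i (role l)).
Proof. by case: k l => [|[|[|[|//]]]] [|[|[|[|//]]]] // _ _ _; rewrite /joined /= !eqxx. Qed.

Lemma joined_Rim_Pole i s : joined (Rim i) (Pole s).
Proof. by rewrite /joined orbT. Qed.

Lemma joined_rims s i : joined (corner s i 1) (corner s i 2).
Proof. by rewrite /joined /= eqxx. Qed.

Lemma eq_Gad s i r t j q : (Gad s i r == Gad t j q) = [&& s == t, i == j & r == q].
Proof. by rewrite -(can_eq vtx_codeK) /= /eq_op /= /eq_op /= andbA. Qed.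

Lemma eq_Rim i j : (Rim i == Rim j) = (i == j :> nat).
Proof. by rewrite -(can_eq vtx_codeK). Qed.

Lemma eq_Gad_role s i k l : (Gad s i (role k) == Gad s i (role l)) = (k == l %[mod 4]).
Proof. by rewrite eq_Gad !eqxx. Qed.

Lemma eq_corner s i k l : k < 3 -> l < 3 -> (corner s i k == corner s i l) = (k == l).
Proof.
case: k l => [|[|[|//]]] [|[|[|//]]] // _ _;
  rewrite ?eqxx // eq_Rim /= /bump leq0n; lia.
Qed.

Lemma eq_corner_Gad s i k t j r : (corner s i k == Gad t j r) = false.
Proof. by case: k => [|[|k]]. Qed.

(** The easy direction of Menger: of three routes on disjoint vertex lists, one survives the
    deletion of two vertices. *)
Lemma avoid3 (T : finType) (S : {set T}) (l1 l2 l3 : seq T) :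
  #|S| < 3 -> uniq (l1 ++ l2 ++ l3) ->
  [|| all (fun x => x \notin S) l1, all (fun x => x \notin S) l2
    | all (fun x => x \notin S) l3].
Proof.
move=> S3; apply: contraTT; rewrite !negb_or -!has_predC.
case/and3P=> /hasP[x1 l1x /negPn/= S1] /hasP[x2 l2x /negPn/= S2] /hasP[x3 l3x /negPn/= S3'].
apply/negP; rewrite !cat_uniq => /and5P[_ n1 _ n2 _].
have x13 y : y \in l2 ++ l3 -> x1 != y.
  by move=> y23; apply: contraNneq n1 => e; apply/hasP; exists y => //; rewrite -e.
have x23 : x2 != x3.
  by apply: contraNneq n2 => e; apply/hasP; exists x3 => //; rewrite -e.
suff : size [:: x1; x2; x3] <= #|S| by rewrite leqNgt S3.
rewrite cardE; apply: uniq_leq_size.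
  by rewrite /= !inE negb_or !x13 ?mem_cat ?l2x ?l3x ?orbT // x23.
by move=> y; rewrite !inE mem_enum => /or3P[] /eqP->.
Qed.

(** * 3-connectivity *)

Section Connectivity.
Variable S : {set G}.
Hypothesis S3 : #|S| < 3.
Local Notation linked := (connect (Defs.induced (~: S))).

Lemma linked_sym (x y : G) : linked x y = linked y x.
Proof.
apply: sym_connect_sym => u v; rewrite /Defs.induced /=; rewrite joined_sym.
by rewrite andbCA.
Qed.

Lemma linked1 (x y : G) : x \notin S -> y \notin S -> joined x y -> linked x y.
Proof. by move=> Sx Sy xy; apply: connect1; rewrite /Defs.induced /= !finset.in_setC Sx Sy. Qed.

(** A triangle: what survives of it is connected, so it suffices to link every surviving vertex to
    it. *)
Definition base : seq vtx := [:: Pole false; Pole true; Rim ord0].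

Lemma linked_base (x y : G) : x \in base -> y \in base ->
  x \notin S -> y \notin S -> linked x y.
Proof.
move=> xb yb Sx Sy; have [->//|nxy] := eqVneq x y; apply: linked1 => //.
move: xb yb nxy; rewrite !inE => /or3P[] /eqP-> /or3P[] /eqP->; rewrite ?eqxx //.
Qed.

Lemma rim_to_base (i : 'I_61) : Rim i \notin S ->
  exists2 b : G, b \in base & b \notin S /\ linked (Rim i) b.
Proof.
case: i => n; elim: n => [|n IH] ltn Si.
  by exists (Rim (Ordinal ltn)) => //; rewrite !inE eq_Rim.
have := @avoid3 G S [:: Pole false] [:: Pole true] [:: Rim (Ordinal (ltnW ltn))] S3 isT.
rewrite /= !andbT => /or3P[] Sy.
- exists (Pole false); first by rewrite !inE.
  by split=> //; apply: linked1 => //; exact: joined_Rim_Pole.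
- exists (Pole true); first by rewrite !inE.
  by split=> //; apply: linked1 => //; exact: joined_Rim_Pole.
have [b bb [Sb lb]] := IH (ltnW ltn) Sy; exists b => //; split=> //.
apply: connect_trans lb; apply: linked1 => //.
by rewrite /joined /= eqxx orbT.
Qed.

Lemma corner_to_base s i k : corner s i k \notin S ->
  exists2 b : G, b \in base & b \notin S /\ linked (corner s i k) b.
Proof.
case: k => [|[|k]]; [|exact: rim_to_base..].
by move=> Sk; exists (Pole s) => //; case: s {Sk}; rewrite !inE.
Qed.

Lemma gad_to_corner s i r : Gad s i r \notin S ->
  exists2 k, corner s i k \notin S & linked (Gad s i r) (corner s i k).
Proof.
have via k l m : k < 4 -> l < 3 -> m < 3 -> k != l -> l != m -> Gad s i (role k) \notin S ->
    all (fun x => x \notin S) [:: Gad s i (role l); corner s i m] ->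
  exists2 m, corner s i m \notin S & linked (Gad s i (role k)) (corner s i m).
  move=> k4 l3 m3 kl lm Sk /and3P[Sl Sm _]; exists m => //.
  apply: (@connect_trans _ _ (Gad s i (role l))); apply: linked1 => //.
    by apply: joined_Gad => //; exact: ltnW.
  exact: joined_corner.
have direct k l : k < 3 -> l < 3 -> k != l -> Gad s i (role k) \notin S ->
    all (fun x => x \notin S) [:: corner s i l] ->
  exists2 m, corner s i m \notin S & linked (Gad s i (role k)) (corner s i m).
  move=> k3 l3 kl Sk /andP[Sl _]; exists l => //; apply: linked1 => //.
  exact: joined_corner.
(* Three disjoint routes: directly to either adjacent corner, or through role l to corner k. *)
have side k l m : k < 3 -> l < 3 -> m < 3 -> uniq [:: k; l; m] ->
    uniq [:: corner s i l; corner s i m; Gad s i (role l); corner s i k] ->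
    Gad s i (role k) \notin S ->
  exists2 m, corner s i m \notin S & linked (Gad s i (role k)) (corner s i m).
  move=> k3 l3 m3 + u Sk; rewrite /= !inE !negb_or => /and3P[/andP[kl km] lm _].
  have := @avoid3 G S [:: corner s i l] [:: corner s i m] [:: Gad s i (role l); corner s i k] S3 u.
  case/or3P=> h; [exact: direct h|exact: direct h|].
  by apply: via h => //; [exact: ltnW|rewrite eq_sym].
have lo_hi : (corner s i 1 == corner s i 2) = false by rewrite eq_corner.
have hi_lo : (corner s i 2 == corner s i 1) = false by rewrite eq_corner.
rewrite /= in lo_hi hi_lo.
elim/roleP: r => Sr.
- by apply: (@side 0 1 2); rewrite //= !inE ?hi_lo ?lo_hi.
- by apply: (@side 1 0 2); rewrite //= !inE ?hi_lo ?lo_hi.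
- by apply: (@side 2 0 1); rewrite //= !inE ?hi_lo ?lo_hi.
(* The centre has disjoint routes through a, b, c; the corners are shifted cyclically since role k
   misses corner k. *)
have u : uniq ([:: Gad s i (role 0); corner s i 1] ++
  [:: Gad s i (role 1); corner s i 2] ++ [:: Gad s i (role 2); corner s i 0]).
  by rewrite /= !inE !eq_Gad_role lo_hi.
by case/or3P: (@avoid3 G S _ _ _ S3 u) => h; apply: via h.
Qed.

Lemma to_base (x : G) : x \notin S ->
  exists2 b : G, b \in base & b \notin S /\ linked x b.
Proof.
case: x => [s|i|s i r] Sx; [exact: (@corner_to_base s ord0 0)|exact: rim_to_base|].
have [k Sk lk] := gad_to_corner Sx; have [b bb [Sb lb]] := corner_to_base Sk.
by exists b => //; split=> //; exact: connect_trans lk lb.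
Qed.

End Connectivity.

(** * Degrees *)

Lemma size_le_card (T : finType) (A : {pred T}) (l : seq T) :
  uniq l -> all (mem A) l -> size l <= #|A|.
Proof.
move=> lu /allP lA; rewrite cardE; apply: uniq_leq_size => // x /lA.
by rewrite mem_enum.
Qed.

Lemma size_le_deg (x : vtx) (l : seq vtx) : uniq l -> all (joined x) l -> size l <= @deg G x.
Proof.
move=> lu /allP lx; apply: (@size_le_card G) => //.
by apply/allP => y /lx; rewrite /= finset.in_set.
Qed.

Lemma deg_Pole_ge5 s : 4 < deg (Pole s : G).
Proof.
apply: (@size_le_deg (Pole s) [seq Rim (inZp k) | k <- iota 0 5]).
  by rewrite map_inj_in_uniq ?iota_uniq // => k l; rewrite !mem_iota => /= k5 l5 [/eqP];
    rewrite !modn_small; lia.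
by apply/allP => _ /mapP[k _ ->].
Qed.

Lemma card_G_ge5 : 4 < #|G|.
Proof. exact: leq_trans (deg_Pole_ge5 false) (max_card _). Qed.

Lemma k_connected_G : k_connected G 3.
Proof.
split; first exact: leq_ltn_trans card_G_ge5.
move=> S S3 x y; rewrite !finset.in_setC => Sx Sy.
have [b bb [Sb lb]] := to_base S3 Sx; have [c cb [Sc lc]] := to_base S3 Sy.
apply: connect_trans lb _; rewrite linked_sym.
by apply: connect_trans lc _; exact: linked_base.
Qed.

(** The last x_i starts no triangle, so it is taken as the end of the one before. *)
Lemma Rim_corner i : exists j k, [/\ 0 < k, k < 3 & forall s, Rim i = corner s j k].
Proof.
have [i60|i60] := ltnP i 60.
  by exists (Ordinal i60), 1; split=> // s; congr Rim; apply: val_inj.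
exists (Ordinal (isT : 59 < 60)), 2; split=> // s; congr Rim; apply: val_inj => /=.
by apply/eqP; rewrite eqn_leq i60 -ltnS ltn_ord.
Qed.

Lemma deg_Rim_ge5 i : 4 < deg (Rim i : G).
Proof.
have [j [k [k0 k3 ik]]] := Rim_corner i.
have h l m : l < 3 -> m < 3 -> k != l -> k != m -> l != m -> 4 < deg (Rim i : G).
  move=> l3 m3 kl km lm.
  have gad s n : n < 3 -> k != n -> joined (Rim i) (Gad s j (role n)).
    by move=> n3 kn; rewrite (ik s) joined_sym joined_corner // eq_sym.
  have ml : (l == m %[mod 4]) = false.
    by rewrite !modn_small ?(negbTE lm) // ltnW.
  (* One pole and two vertices of each of the two gadgets on a single edge of the path: available
     also at the ends of the path. *)
  apply: (@size_le_deg (Rim i) [:: Pole false; Gad false j (role l); Gad false j (role m);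
    Gad true j (role l); Gad true j (role m)]).
    by rewrite !cons_uniq !inE !eq_Gad_role ml !eq_Gad.
  by rewrite /all joined_Rim_Pole !gad.
have [k1|k2] : k = 1 \/ k = 2 by lia.
  by apply: (h 0 2); rewrite ?k1.
by apply: (h 0 1); rewrite ?k2.
Qed.

Lemma deg_role_ge5 s i k : k < 3 -> 4 < deg (Gad s i (role k) : G).
Proof.
move=> k3.
have [l [m [l3 m3 kl km lm]]] : exists l m, [/\ l < 3, m < 3, k != l, k != m & l != m].
  by case: k k3 => [|[|[|//]]] _; [exists 1, 2|exists 0, 2|exists 0, 1].
have [l4 m4] : l < 4 /\ m < 4 by split; exact: ltnW.
apply: (@size_le_deg (Gad s i (role k)) [:: corner s i l; corner s i m;
  Gad s i (role l); Gad s i (role m); Gad s i (role 3)]).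
  rewrite !cons_uniq !inE !eq_corner_Gad eq_corner // !eq_Gad_role.
  rewrite (negbTE lm) !modn_small // (negbTE lm) !ltn_eqF //.
have [k4 kn3] : k < 4 /\ k != 3 by rewrite ltn_eqF // ltnW.
by rewrite /all !joined_corner // !joined_Gad.
Qed.

(** * Distances between the centres *)

Definition centre (s : bool) (i : 'I_60) : vtx := Gad s i (role 3).

Lemma joined_centre s i y : joined (centre s i) y = (y \in [seq Gad s i (role k) | k <- iota 0 3]).
Proof.
case: y => [t|j|t j r].
- by rewrite /joined /= ?andbF !inE.
- by rewrite /joined /= !andbF !inE.
by rewrite /joined /= !inE !eq_Gad; elim/roleP: r; rewrite /= ?andbF ?andbT ?orbF ?orbT.
Qed.

Lemma deg_centre s i : deg (centre s i : G) = 3.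
Proof.
rewrite /deg -[3](_ : size [seq Gad s i (role k) | k <- iota 0 3] = 3) //.
rewrite -(card_uniqP _); last by rewrite /= !inE !eq_Gad_role.
by apply: eq_card => y; rewrite finset.in_set; exact: joined_centre.
Qed.

Lemma small_deg_centre (x : G) :
  reflect (exists s i, x = centre s i) (x \in small_deg G 5).
Proof.
rewrite finset.in_set; apply: (iffP idP) => [|[s [i ->]]]; last by rewrite deg_centre.
case: x => [s|i|s i r].
- by rewrite ltnNge deg_Pole_ge5.
- by rewrite ltnNge deg_Rim_ge5.
elim/roleP: r; [by rewrite ltnNge deg_role_ge5..|by exists s, i].
Qed.

(* A lower bound for the distance from [centre s i] that is 1-Lipschitz
   along edges. *)
Definition level (s : bool) (i : 'I_60) (y : vtx) : nat :=
  match y with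
  | Gad t j r =>
      if (t == s) && (j == i) then nat_of_bool (r != role 3)
      else if r == role 3 then 4 else 3
  | _ => 2
  end.

Lemma level_arrow s i x y : arrow x y ->
  level s i y <= (level s i x).+1 /\ level s i x <= (level s i y).+1.
Proof.
case: x y => [t|j|t j r] [t'|j'|t' j' r'] //=.
- by case/andP => _; case: ifP => _; elim/roleP: r'.
- by case: ifP => _; elim/roleP: r' => //=; rewrite !andbF.
- by case/and3P => /eqP-> /eqP-> _; case: ifP => _; elim/roleP: r; elim/roleP: r'.
Qed.

Lemma level_joined s i x y : joined x y -> level s i y <= (level s i x).+1.
Proof. by case/orP => /(level_arrow s i) []. Qed.

Lemma level_path s i (x : G) p : path (@adj G) x p ->
  level s i (last x p) <= level s i x + size p.
Proof.
elim: p x => [|y p IH] x /=; first by rewrite addn0.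
case/andP => /(level_joined s i) xy /IH /leq_trans; apply.
by rewrite addnS -addSn leq_add2r.
Qed.

Lemma dist_centre_ge4 s i t j : (s, i) != (t, j) -> 3 < dist (centre s i : G) (centre t j).
Proof.
move=> ne; rewrite ltnNge; apply/negP => d3.
(* Below [#|G|] the value of [find] comes from a genuine walk, here of length at most 3, along which
   [level] would have to rise from 0 to 4. *)
have dG : dist (centre s i : G) (centre t j) < size (iota 0 #|G|).
  by rewrite size_iota; apply: leq_ltn_trans d3 _; exact: ltnW card_G_ge5.
have := dG; rewrite -has_find => /(nth_find 0).
rewrite nth_iota; last by rewrite size_iota in dG.
case/existsP => p /andP[] /(level_path s i) + /eqP lp; rewrite lp size_tuple add0n.
rewrite -/(dist _ _) /= !eqxx /=.
move: ne; rewrite xpair_eqE eq_sym [i == j]eq_sym => /negbTE->; lia.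
Qed.

Lemma dist_le (x y : G) n : n < #|G| -> walk n x y -> dist x y <= n.
Proof.
move=> nG w; rewrite leqNgt; apply/negP => /(before_find 0).
by rewrite nth_iota // add0n w.
Qed.

(** The gadgets on the two sides of the edge x_0 x_1 share the corner x_0, through which the walk
    goes. *)
Lemma dist_centres : dist (centre false ord0 : G) (centre true ord0) <= 4.
Proof.
apply: dist_le; first exact: card_G_ge5.
apply/existsP; exists [tuple (Gad false ord0 (role 0) : G); Rim ord0 : G;
  Gad true ord0 (role 0) : G; centre true ord0 : G].
by rewrite /= eqxx.
Qed.

Lemma bigmin_le (I : finType) (P : pred I) (F : I -> nat) m j :
  P j -> \big[minn/m]_(i | P i) F i <= F j.
Proof.
have: j \in index_enum I by rewrite mem_index_enum.
elim: (index_enum I) => // i r IH; rewrite inE big_cons => /predU1P[<- ->|/IH h /h].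
  exact: geq_minl.
by case: ifP => // _; apply: leq_trans; exact: geq_minr.
Qed.

Lemma le_bigmin (I : finType) (P : pred I) (F : I -> nat) m k :
  k <= m -> (forall j, P j -> k <= F j) -> k <= \big[minn/m]_(i | P i) F i.
Proof. by move=> km kF; elim/big_ind: _ => // a b ka kb; rewrite leq_min ka. Qed.

Lemma centre_independent s i t j : ~~ joined (centre s i) (centre t j).
Proof. by rewrite joined_centre !inE !eq_Gad !andbF. Qed.

(** Centres are pairwise non-adjacent, so each component is a single centre. *)
Lemma component_centre (A : {set G}) :
  reflect (exists s i, A = finset.set1 (centre s i : G)) (A \in components (small_deg G 5)).
Proof.
have comp s i : [set y in small_deg G 5 | connect (Defs.induced (small_deg G 5)) (centre s i : G) y]
    = finset.set1 (centre s i : G).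
  apply/setP => y; rewrite !finset.inE; apply/andP/eqP => [[_]|->]; last first.
    by rewrite deg_centre connect0.
  case/connectP => -[|z p] /=; first by [].
  case/andP => /and3P[_ /small_deg_centre[t [j ->]]].
  by move/(negP (centre_independent s i t j)).
apply: (iffP imsetP) => [[x /small_deg_centre[s [i ->]] ->]|[s [i ->]]].
  by exists s, i; rewrite comp.
by exists (centre s i); [apply/small_deg_centre; exists s, i|rewrite comp].
Qed.

Lemma comp_dist_G : comp_dist (small_deg G 5) = 4.
Proof.
have c12 : finset.set1 (centre false ord0 : G) != finset.set1 (centre true ord0 : G).
  by apply/eqP => /finset.set1_inj.
have C s i : finset.set1 (centre s i : G) \in components (small_deg G 5).
  by apply/component_centre; exists s, i.
rewrite /comp_dist ifN; last first.
  by rewrite -ltnNge; apply/card_gt1P; exists (finset.set1 (centre false ord0 : G)),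
    (finset.set1 (centre true ord0 : G)).
apply/eqP; rewrite eqn_leq; apply/andP; split.
  apply: leq_trans (bigmin_le _ _ (C false ord0)) _.
  apply: leq_trans (@bigmin_le _ _ _ _ (finset.set1 (centre true ord0 : G)) _) _.
    by rewrite C c12.
  apply: leq_trans (bigmin_le _ _ (finset.set11 _)) _.
  apply: leq_trans (bigmin_le _ _ (finset.set11 _)) _.
  exact: dist_centres.
(* The default [#|G|] of the minima has to be at least 4 as well. *)
have G4 : 3 < #|G| by exact: ltnW card_G_ge5.
apply: le_bigmin => // _ /component_centre[s [i ->]].
apply: le_bigmin => // _ /andP[/component_centre[t [j ->]] ne].
apply: le_bigmin => // _ /finset.set1P ->; apply: le_bigmin => // _ /finset.set1P ->.
by apply: dist_centre_ge4; apply: contraNneq ne => -[-> ->].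
Qed.

(** * Lists and non-colourability *)

Definition rest (p q : nat) : seq nat := [seq c <- iota 0 5 | (c != p) && (c != q)].

Definition pole_colors : seq (nat * nat) :=
  [seq c <- [seq (p, q) | p <- iota 0 5, q <- iota 0 5] | c.1 != c.2].

(* The colours of [Pole s], x_i, x_(i+1) that do not extend to the gadget. *)
Definition killed (s : bool) (i : nat) : seq nat :=
  let: (p, q) := nth (0, 0) pole_colors (i %/ 3) in
  let r k := nth 0 (rest p q) k in
  match i %% 3, s with
  | 0, false => [:: p; r 1; r 0]
  | 0, true  => [:: q; r 2; r 0]
  | 1, false => [:: p; r 2; r 1]
  | 1, true  => [:: q; r 1; r 2]
  | _, false => [:: p; r 0; r 1]
  | _, true  => [:: q; r 0; r 2]
  end.

Definition gadget_colors (s : bool) (i r : nat) : seq nat :=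
  iota 5 3 ++ (if r < 3 then [seq nth 0 (killed s i) k | k <- iota 0 3 & k != r] else [::]).

Definition colors (x : vtx) : seq nat :=
  if x is Gad s i r then gadget_colors s i r else iota 0 5.

(** Contains every colour that x_n can receive when the poles have colours [p] and [q], by
    propagation along the path. *)
Fixpoint rim_colors (p q n : nat) : seq nat :=
  if n is i.+1 then
    let l := rim_colors p q i in
    [seq c' <- rest p q | has (fun c =>
       [&& c != c', killed false i != [:: p; c; c'] & killed true i != [:: q; c; c']]) l]
  else rest p q.

(** The three edges reserved for (p, q) leave no colour, whatever subset of [rest p q] arrives, and
    an empty list stays empty. The 20 pairs are checked by evaluation. *)
Lemma rim_colors60 p q : p < 5 -> q < 5 -> p != q -> rim_colors p q 60 = [::].
Proof.
move=> p5 q5 pq; suff /allP h : all (fun c => rim_colors c.1 c.2 60 == [::]) pole_colors.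
  apply/eqP; apply: (h (p, q)); rewrite mem_filter; apply/andP; split=> //.
  by apply: allpairs_f; rewrite mem_iota.
by vm_cast_no_check (erefl true).
Qed.

(** Each killed triple consists of three distinct colours below 5. *)
Lemma uniq_gadget_colors s (i : 'I_60) (r : 'I_4) : uniq (gadget_colors s i r).
Proof.
have /allP h : all (fun c => all (fun r => uniq (gadget_colors c.1 c.2 r)) (iota 0 4)) cells.
  by vm_cast_no_check (erefl true).
by have /allP := h _ (mem_cells s i); apply; rewrite mem_iota ltn_ord.
Qed.

Lemma uniq_colors x : uniq (colors x).
Proof. by case: x => [s|i|s i r]; [exact: iota_uniq..|exact: uniq_gadget_colors]. Qed.

Lemma size_colors (x : G) : size (colors x) = minn (deg x) 5.
Proof.
case: x => [s|i|s i r].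
- by rewrite size_iota (minn_idPr (deg_Pole_ge5 s)).
- by rewrite size_iota (minn_idPr (deg_Rim_ge5 i)).
elim/roleP: r; [by rewrite (minn_idPr (deg_role_ge5 _ _ _))..|].
by rewrite deg_centre.
Qed.

Lemma not_L_colorable_G (L : G -> {fset nat}) :
  (forall x, L x =i colors x) -> ~ L_colorable L.
Proof.
move=> LE [phi [phiL proper]].
have phiC x : phi x \in colors x by rewrite -LE.
have phiN x y : joined x y -> phi x != phi y by exact: proper.
have not_killed s (i : 'I_60) :
    killed s i != [:: phi (corner s i 0); phi (corner s i 1); phi (corner s i 2)].
  apply/negP => /eqP K.
  (* With the killed colours on the corners, each of a, b, c loses its two additional colours to its
     adjacent corners. *)
  have new k : k < 4 -> phi (Gad s i (role k)) \in iota 5 3.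
    move=> k4; have := phiC (Gad s i (role k)).
    rewrite mem_cat => /orP[//|]; rewrite [nat_of_ord _]modn_small //.
    case: ifP => // k3 /mapP[l]; rewrite mem_filter mem_iota => /andP[lk l3] e.
    have : phi (Gad s i (role k)) != phi (corner s i l).
      by apply: phiN; apply: joined_corner => //; rewrite eq_sym.
    by rewrite e K; case: l l3 {lk e} => [|[|[|//]]] _ /=; rewrite eqxx.
  (* The four gadget vertices are pairwise adjacent, too many for three colours. *)
  have : uniq [seq phi (Gad s i (role k)) | k <- iota 0 4].
    rewrite map_inj_in_uniq ?iota_uniq // => k l; rewrite !mem_iota => /= k4 l4 e.
    apply/eqP; apply/negP => /negP kl.
    by have := phiN _ _ (joined_Gad s i k4 l4 kl); rewrite e eqxx.
  move/uniq_leq_size => /(_ (iota 5 3)); rewrite size_map !size_iota.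
  have sub : {subset [seq phi (Gad s i (role k)) | k <- iota 0 4] <= iota 5 3}.
    by move=> _ /mapP[k k4 ->]; apply: new; rewrite mem_iota in k4.
  by move/(_ sub).
set p := phi (Pole false); set q := phi (Pole true).
have rimC (i : 'I_61) : phi (Rim i) \in rest p q.
  rewrite mem_filter !phiN ?joined_Rim_Pole //; exact: phiC (Rim i).
have inv n (ltn : n < 61) : phi (Rim (Ordinal ltn)) \in rim_colors p q n.
  elim: n ltn => [|n IH] ltn; first exact: rimC.
  rewrite /rim_colors -/rim_colors mem_filter rimC andbT; apply/hasP.
  exists (phi (Rim (Ordinal (ltnW ltn)))); first exact: IH.
  (* [n.+1 < 61] is convertible to [n < 60], so [ltn] also bounds the index of the triangle. *)
  have c1 s : Rim (Ordinal (ltnW ltn)) = corner s (Ordinal (ltn : n < 60)) 1.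
    by congr Rim; apply: val_inj.
  have c2 s : Rim (Ordinal ltn) = corner s (Ordinal (ltn : n < 60)) 2.
    by congr Rim; apply: val_inj.
  apply/and3P; split.
  - by apply: phiN; rewrite (c1 true) (c2 true) joined_rims.
  - by rewrite (c1 false) (c2 false); exact: (not_killed false (Ordinal (ltn : n < 60))).
  - by rewrite (c1 true) (c2 true); exact: (not_killed true (Ordinal (ltn : n < 60))).
have := inv 60 isT; rewrite rim_colors60 //.
- by have := phiC (Pole false); rewrite mem_iota.
- by have := phiC (Pole true); rewrite mem_iota.
- exact: phiN.
Qed.

Theorem theorem9 (R : realType) :
  exists (G : sgraph) (L : G -> {fset nat}),
    planar R G /\ k_connected G 3 /\ ~ complete G /\
    comp_dist (small_deg G 5) = 4 /\
    (forall v : G, #|` L v|%fset = minn (deg v) 5) /\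
    ~ L_colorable L.
Proof.
exists G, (fun x => [fset c in colors x]%fset).
split; first exact: planar_G.
split; first exact: k_connected_G.
split.
  move=> /(_ (centre false ord0) (centre true ord0)).
  by rewrite eq_Gad => /(_ isT); exact/negP/centre_independent.
split; first exact: comp_dist_G.
split=> [x|]; first by rewrite card_fseq (undup_id (uniq_colors x)) size_colors.
by apply: not_L_colorable_G => x c; rewrite inE.
Qed.
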